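(* Let $n\ge1$. The finite representation property holds for the signature $(\langle\ \rangle;,\mathsf A_1,\dots,\mathsf A_n)$ for representation by $n$-ary partial functions: every finite $(\langle\ \rangle;,\mathsf A_1,\dots,\mathsf A_n)$-algebra that is representable by $n$-ary partial functions is isomorphic to an algebra of $n$-ary partial functions (of the same signature) with a finite base.
   Context: Fix $n\ge 1$; $i$ ranges over $\{1,\dots,n\}$. The signature has an $(n+1)$-ary operation (composition), written $\langle a_1,\dots,a_n\rangle ; b$ (also $\boldsymbol a; b$), and unary operations $\mathsf A_1,\dots,\mathsf A_n$. Algebras are nonempty. An $n$-ary partial function on a set $X$ is a set $f\subseteq X^{n+1}$ such that $(\boldsymbol x,y),(\boldsymbol x,z)\in f$ implies $y=z$ (where $\boldsymbol x\in X^n$). An algebra of $n$-ary partial functions of this signature is an algebra whose elements are $n$-ary partial functions, for which there are a set $X$ (the base) and an equivalence relation $E$ on $X$ such that every tuple $(x_1,\dots,x_{n+1})$ in every element lies in $X^{n+1}$ and has pairwise $E$-equivalent entries, and whose operations are $\boldsymbol f; g=\{(\boldsymbol x,z)\in X^{n+1} : \exists \boldsymbol y\in X^n,\ (\boldsymbol x,y_i)\in f_i \text{ for each } i \text{ and } (\boldsymbol y,z)\in g\}$, $\mathsf A_i(f)=\{(\boldsymbol x,x_i)\in X^{n+1} : x_1,\dots,x_n \text{ all } E\text{-equivalent and there is no } y\in X \text{ with } (\boldsymbol x,y)\in f\}$. An algebra is representable by $n$-ary partial functions if it is isomorphic to an algebra of $n$-ary partial functions of the same signature. *)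

(* Defs.v *)
From mathcomp Require Import all_boot.
From mathcomp Require Import boolp classical_sets functions cardinality.
From Stdlib Require Import RelationClasses.

Set Implicit Arguments.
Unset Strict Implicit.
Unset Printing Implicit Defensive.

Local Open Scope classical_set_scope.

Record algebra (n : nat) := Algebra {
  carrier :> Type;
  carrier_inhabited : inhabited carrier;
  comp : n.-tuple carrier -> carrier -> carrier;
  antidom : 'I_n -> carrier -> carrier }.

Definition isomorphic (n : nat) (A B : algebra n) : Prop :=
  exists h : A -> B,
    [/\ bijective h,
        forall (a : n.-tuple A) (b : A),
          h (comp a b) = comp (map_tuple h a) (h b)
      & forall (i : 'I_n) (a : A), h (antidom i a) = antidom i (h a)].

(* X^(n+1) is split as X^n * X, so that the graph of an n-ary partial function
   is a set of pairs (x, y) with x an n-tuple. *)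
Definition graph (n : nat) (X : Type) : Type := set (n.-tuple X * X).

Definition functional (n : nat) (X : Type) (f : graph n X) : Prop :=
  forall (x : n.-tuple X) (y z : X), f (x, y) -> f (x, z) -> y = z.

Definition pairwise_related (m : nat) (X : Type) (E : X -> X -> Prop)
    (x : m.-tuple X) : Prop :=
  forall i j : 'I_m, E (tnth x i) (tnth x j).

Definition graph_comp (n : nat) (X : Type) (f : n.-tuple (graph n X))
    (g : graph n X) : graph n X :=
  [set p | exists y : n.-tuple X,
     (forall i : 'I_n, tnth f i (p.1, tnth y i)) /\ g (y, p.2)].

Definition graph_antidom (n : nat) (X : Type) (E : X -> X -> Prop) (i : 'I_n)
    (f : graph n X) : graph n X :=
  [set p | [/\ p.2 = tnth p.1 i, pairwise_related E p.1
             & ~ exists y : X, f (p.1, y)]].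

Record pfun_algebra (n : nat) (X : Type) := PfunAlgebra {
  base_rel : X -> X -> Prop;
  base_rel_equiv : Equivalence base_rel;
  elements : set (graph n X);
  elements_nonempty : elements !=set0;
  elements_functional : forall f, elements f -> functional f;
  elements_related : forall f, elements f -> forall (x : n.-tuple X) (y : X),
    f (x, y) -> pairwise_related base_rel (rcons_tuple x y);
  elements_comp : forall (f : n.-tuple (graph n X)) (g : graph n X),
    (forall i : 'I_n, elements (tnth f i)) -> elements g ->
    elements (graph_comp f g);
  elements_antidom : forall (i : 'I_n) (f : graph n X),
    elements f -> elements (graph_antidom base_rel i f) }.

Section ToAlgebra.
Variables (n : nat) (X : Type) (P : pfun_algebra n X).

Lemma elements_inhabited : inhabited (set_type (elements P)).
Proof. by have [f Pf] := elements_nonempty P; split; exists f; apply: mem_set. Qed.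

Lemma elements_tuple (f : n.-tuple (set_type (elements P))) (i : 'I_n) :
  elements P (tnth (map_tuple set_val f) i).
Proof. by rewrite tnth_map; apply: set_valP. Qed.

Definition pfun_comp (f : n.-tuple (set_type (elements P)))
    (g : set_type (elements P)) : set_type (elements P) :=
  SigSub (mem_set (elements_comp (elements_tuple f) (set_valP g))).

Definition pfun_antidom (i : 'I_n) (f : set_type (elements P)) :
    set_type (elements P) :=
  SigSub (mem_set (elements_antidom i (set_valP f))).

Definition algebra_of_pfun : algebra n :=
  Algebra elements_inhabited pfun_comp pfun_antidom.

End ToAlgebra.

Definition representable (n : nat) (A : algebra n) : Prop :=
  exists (X : Type) (P : pfun_algebra n X), isomorphic A (algebra_of_pfun P).

Definition finitely_representable (n : nat) (A : algebra n) : Prop :=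
  exists (X : Type) (P : pfun_algebra n X),
    finite_set [set: X] /\ isomorphic A (algebra_of_pfun P).

(* Main.v *)
Require Import Defs.
From mathcomp Require Import all_boot.
From mathcomp Require Import boolp classical_sets functions cardinality.
From Stdlib Require Import RelationClasses.

(** In a finite algebra of partial functions, finitely many tuples decide which
    elements are equal, and only finitely many points are reached from each.

    Let [P] be an algebra of [n]-ary partial functions over [X], and let [t] be
    an [n]-tuple over [X]. The orbit of [t], the set of all values [f t] with
    [f] an element defined at [t], has at most as many points as [P] has
    elements. It is closed under every element, because
    [f (g_1 t, ..., g_n t) = (g; f) t]. Hence restricting the elements to the
    orbit preserves composition (no intermediate value leaves the orbit) and
    antidomain (an element undefined on the orbit was already undefined on
    [X]).

    A single orbit may identify distinct elements, but if [f] and [g] differ at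
    [t], then their restrictions to the orbit of [t] differ as well: the
    entries of [t] lie in their own orbit, since the [i]-th projection is an
    element, namely the [i]-th antidomain of the empty function
    [(A_1 f, ..., A_n f); f].

    So choose one separating tuple for each pair of distinct elements. The
    disjoint union of the finitely many orbits is the finite base
    ([localization]). The equivalence relation of the new representation makes
    each orbit a class, so that antidomains, like all other elements, stay
    undefined on tuples whose entries come from different orbits. *)

Set Implicit Arguments.
Unset Strict Implicit.
Unset Printing Implicit Defensive.

Local Open Scope classical_set_scope.

Lemma pairwise_related_rcons (n : nat) (X : Type) (E : X -> X -> Prop)
    (x : n.-tuple X) (y : X) :
  pairwise_related E (rcons_tuple x y) ->
  pairwise_related E x /\ forall i, E (tnth x i) y.
Proof.
move=> Exy.
have tnth_init i : tnth (rcons_tuple x y) (widen_ord (leqnSn n) i) = tnth x i.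
  by rewrite (tnth_nth y) /= nth_rcons size_tuple ltn_ord -tnth_nth.
have tnth_last : tnth (rcons_tuple x y) ord_max = y.
  by rewrite (tnth_nth y) /= nth_rcons size_tuple ltnn eqxx.
split=> [i j|i]; first by rewrite -!tnth_init; apply: Exy.
by rewrite -[X in E _ X]tnth_last -tnth_init; apply: Exy.
Qed.

Section Localization.
Variables (n : nat) (n_ge1 : 1 <= n) (X : Type) (P : pfun_algebra n X).
Variable points : set (n.-tuple X).

(** Pairing each value with the tuple it is reached from makes the union of the
    orbits disjoint. *)
Definition orbits : set (n.-tuple X * X) :=
  [set p | points p.1 /\ exists2 f, elements P f & f p].

Definition origin (u : set_type orbits) : n.-tuple X := (set_val u).1.
Definition value (u : set_type orbits) : X := (set_val u).2.

Definition same_origin (u v : set_type orbits) : Prop := origin u = origin v.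

Definition localize (f : graph n X) : graph n (set_type orbits) :=
  [set p | (forall i, same_origin (tnth p.1 i) p.2)
           /\ f (map_tuple value p.1, value p.2)].

Lemma same_origin_equiv : Equivalence same_origin.
Proof.
by split=> [u|u v|u v w]; rewrite /same_origin => // -> //.
Qed.

Lemma origin_value_inj (u v : set_type orbits) :
  origin u = origin v -> value u = value v -> u = v.
Proof.
move=> uv_origin uv_value; apply: val_inj.
by rewrite [LHS]surjective_pairing [RHS]surjective_pairing; congr pair.
Qed.

(** An orbit is closed under the elements, since [f (g t) = (g; f) t]. *)
Lemma orbits_closed (t : n.-tuple X) (z : n.-tuple (set_type orbits))
    (f : graph n X) (y : X) :
  (forall i, origin (tnth z i) = t) -> elements P f ->
  f (map_tuple value z, y) -> exists2 w, origin w = t & value w = y.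
Proof.
move=> zt Pf fzy.
have /choice[g gP] i : exists g, elements P g /\ g (t, value (tnth z i)).
  have [_ [g Pg gz]] := set_valP (tnth z i).
  exists g; split => //.
  by rewrite -(zt i) -surjective_pairing.
have Oty : orbits (t, y).
  split.
    rewrite /= -(zt (Ordinal n_ge1)).
    by have [] := set_valP (tnth z (Ordinal n_ge1)).
  exists (graph_comp (mktuple g) f).
    apply: elements_comp => // i; rewrite tnth_mktuple.
    by have [] := gP i.
  exists (map_tuple value z); split=> //= i.
  by rewrite tnth_mktuple tnth_map; have [] := gP i.
by exists (SigSub (mem_set Oty)).
Qed.

(** All values of elements at one tuple are equivalent to its first entry. *)
Lemma value_related (u v : set_type orbits) :
  same_origin u v -> base_rel P (value u) (value v).
Proof.
have [Er Es Et] := base_rel_equiv P.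
have Eorigin w : base_rel P (tnth (origin w) (Ordinal n_ge1)) (value w).
  have [_ [f Pf]] := set_valP w.
  rewrite [val w]surjective_pairing => fw.
  by have [_] := pairwise_related_rcons (elements_related Pf fw); apply.
by move=> uv; apply: (Et _ _ _ (Es _ _ (Eorigin u))); rewrite uv; apply: Eorigin.
Qed.

Lemma localize_functional (f : graph n X) :
  elements P f -> functional (localize f).
Proof.
move=> Pf z u v [zu fzu] [zv fzv].
apply: origin_value_inj; last exact: elements_functional Pf _ _ _ fzu fzv.
by rewrite -(zu (Ordinal n_ge1)) (zv (Ordinal n_ge1)).
Qed.

Lemma localize_related (f : graph n X) (z : n.-tuple (set_type orbits))
    (w : set_type orbits) :
  localize f (z, w) -> pairwise_related same_origin (rcons_tuple z w).
Proof.
move=> [/= zw _].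
suff tnth_w k : same_origin (tnth (rcons_tuple z w) k) w.
  by move=> i j; rewrite /same_origin !tnth_w.
rewrite (tnth_nth w) /= nth_rcons size_tuple.
case: ifP => [kn|_]; last by rewrite if_same.
by rewrite -[k : nat]/(Ordinal kn : nat) -tnth_nth.
Qed.

(** Intermediate values of a composition stay in the orbit of the arguments;
    conversely, equality of origins passes through any intermediate tuple. *)
Lemma localize_comp (f : n.-tuple (graph n X)) (g : graph n X) :
  (forall i, elements P (tnth f i)) -> elements P g ->
  localize (graph_comp f g) = graph_comp (map_tuple localize f) (localize g).
Proof.
move=> Pf Pg; apply/seteqP; split=> -[z w] /=.
  move=> [/= zw [y [/= fzy gyw]]].
  have /choice[u uP] i : exists u, origin u = origin w /\ value u = tnth y i.
    have [u] := orbits_closed zw (Pf i) (fzy i).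
    by exists u.
  have valueu : map_tuple value (mktuple u) = y.
    by apply: eq_from_tnth => i; rewrite tnth_map tnth_mktuple; case: (uP i).
  exists (mktuple u); split=> [i|] /=.
    rewrite tnth_map tnth_mktuple; have [uw uy] := uP i.
    split=> [j|] /=; first by rewrite /same_origin zw uw.
    by rewrite uy.
  split=> [i|] /=; last by rewrite valueu.
  by rewrite tnth_mktuple; case: (uP i).
move=> [u [/= fzu [/= uw guw]]].
split=> [i|] /=.
  have := fzu i; rewrite tnth_map => -[/= zu _].
  by rewrite /same_origin zu uw.
exists (map_tuple value u); split=> //= i.
by have := fzu i; rewrite !tnth_map => -[].
Qed.

(** The right-to-left inclusion rests on orbits being closed: a value of [f] in
    [X] at a tuple of an orbit already lies in that orbit. *)
Lemma localize_antidom (i : 'I_n) (f : graph n X) :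
  elements P f ->
  localize (graph_antidom (base_rel P) i f)
  = graph_antidom same_origin i (localize f).
Proof.
move=> Pf; apply/seteqP; split=> -[z w] /=.
  move=> [/= zw [/= wzi _ fz]]; split=> /=.
  - by apply: origin_value_inj; rewrite ?zw // wzi tnth_map.
  - by move=> j k; rewrite /same_origin !zw.
  - by move=> [v [_ fzv]]; apply: fz; exists (value v).
move=> [/= -> zz fz]; split=> [j|] /=; first exact: zz.
split=> /=.
- by rewrite tnth_map.
- by move=> j k; rewrite !tnth_map; apply/value_related/zz.
- move=> [y fzy]; apply: fz.
  have [v vz vy] := orbits_closed (fun j => zz j i) Pf fzy.
  exists v; split=> [j|] /=; last by rewrite vy.
  by rewrite /same_origin vz; apply: zz.
Qed.

Lemma localize_image_comp (f : n.-tuple (graph n (set_type orbits)))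
    (g : graph n (set_type orbits)) :
  (forall i, (localize @` elements P) (tnth f i)) ->
  (localize @` elements P) g ->
  (localize @` elements P) (graph_comp f g).
Proof.
move=> imf [g' Pg' <-].
have /choice[f' f'P] i :
    exists f', elements P f' /\ localize f' = tnth f i.
  by have [f' Pf' f'E] := imf i; exists f'.
exists (graph_comp (mktuple f') g').
  by apply: elements_comp => // i; rewrite tnth_mktuple; case: (f'P i).
rewrite localize_comp //; last first.
  by move=> i; rewrite tnth_mktuple; case: (f'P i).
congr graph_comp; apply: eq_from_tnth => i.
by rewrite tnth_map tnth_mktuple; case: (f'P i).
Qed.

Lemma localize_image_antidom (i : 'I_n) (f : graph n (set_type orbits)) :
  (localize @` elements P) f ->
  (localize @` elements P) (graph_antidom same_origin i f).
Proof.
move=> [f' Pf' <-]; rewrite -localize_antidom //.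
by exists (graph_antidom (base_rel P) i f') => //; apply: elements_antidom.
Qed.

Program Definition localization : pfun_algebra n (set_type orbits) :=
  @PfunAlgebra n _ same_origin same_origin_equiv (localize @` elements P)
    _ _ _ localize_image_comp localize_image_antidom.
Next Obligation.
by have [f Pf] := elements_nonempty P; exists (localize f), f.
Qed.
Next Obligation. exact: localize_functional. Qed.
Next Obligation. exact: localize_related H0. Qed.

(** Each element contributes at most one point to each orbit, its value there,
    because it is functional. *)
Lemma orbits_finite :
  finite_set points -> finite_set (elements P) -> finite_set orbits.
Proof.
move=> finpoints finP.
pose values t f := [set p : n.-tuple X * X | p.1 = t /\ f p].
apply: (@sub_finite_set _ _ (\bigcup_(t in points)
    \bigcup_(f in elements P) values t f)).
  by move=> p [tp [f Pf fp]]; exists p.1 => //; exists f.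
apply: bigcup_finite => // t _; apply: bigcup_finite => // f Pf.
have [->|/set0P[p [pt fp]]] := eqVneq (values t f) set0.
  exact: finite_set0.
apply: (sub_finite_set _ (finite_set1 p)) => q [qt fq] /=.
move: pt fp qt fq; case: p q => [? y] [? z] /= -> fy -> fz.
by rewrite (elements_functional Pf fy fz).
Qed.

(** The empty function is [(A_1 f, ..., A_n f); f], which applies [f] only where
    it is undefined; its antidomains are the projections. *)
Lemma projection_element (i : 'I_n) :
  exists2 f, elements P f
    & forall t, pairwise_related (base_rel P) t -> f (t, tnth t i).
Proof.
have [f Pf] := elements_nonempty P.
pose empty := graph_comp [tuple graph_antidom (base_rel P) j f | j < n] f.
exists (graph_antidom (base_rel P) i empty).
  apply/elements_antidom/elements_comp => // j.
  by rewrite tnth_mktuple; apply: elements_antidom.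
move=> t tt; split=> // -[y [u [/= Aft fuy]]].
have tu : u = t.
  by apply: eq_from_tnth => j; have := Aft j; rewrite tnth_mktuple => -[].
have := Aft i; rewrite tnth_mktuple => -[/= _ _]; apply.
by exists y; rewrite -tu.
Qed.

(** A tuple of [points] at which [f] is defined has its entries in its own
    orbit, thanks to the projections, and so does the value of [f] there. *)
Lemma localize_separates (f g : graph n X) (t : n.-tuple X) (y : X) :
  points t -> elements P f -> f (t, y) -> localize f = localize g -> g (t, y).
Proof.
move=> pt Pf fty fg.
have tt : pairwise_related (base_rel P) t.
  by case: (pairwise_related_rcons (elements_related Pf fty)).
have Ot i : orbits (t, tnth t i).
  split=> //; have [p Pp pE] := projection_element i.
  by exists p => //; apply: pE.
have Oy : orbits (t, y) by split=> //; exists f.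
pose z := [tuple SigSub (mem_set (Ot i)) : set_type orbits | i < n].
pose w : set_type orbits := SigSub (mem_set Oy).
have valuez : map_tuple value z = t.
  by apply: eq_from_tnth => i; rewrite tnth_map tnth_mktuple.
have : localize f (z, w).
  split=> [i|] /=; first by rewrite tnth_mktuple.
  by rewrite valuez.
by rewrite fg => -[_ /=]; rewrite valuez.
Qed.

End Localization.

Lemma finite_separating_points (n : nat) (X : Type) (F : set (graph n X)) :
  finite_set F ->
  exists2 T : set (n.-tuple X), finite_set T
    & forall f g, F f -> F g ->
        (forall t y, T t -> f (t, y) <-> g (t, y)) -> f = g.
Proof.
move=> finF.
have /choice[S SP] (p : graph n X * graph n X) :
    exists S : set (n.-tuple X), finite_set S
      /\ ((forall t y, S t -> p.1 (t, y) <-> p.2 (t, y)) -> p.1 = p.2).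
  have [fg|] := EM (p.1 = p.2).
    by exists set0; split.
  move=> fg; have /existsNP[[t y] ty] : ~ forall q, p.1 q <-> p.2 q.
    by move=> H; apply: fg; apply/seteqP; split=> q /H.
  exists [set t]; split=> // H; case: ty; exact: H.
exists (\bigcup_(p in F `*` F) S p).
  by apply: bigcup_finite => [|p _]; [apply: finite_setX | case: (SP p)].
move=> f g Ff Fg fg; have [_] := SP (f, g); apply=> t y St.
by apply: fg; exists (f, g).
Qed.

Theorem corollary4p6 (n : nat) (n_ge1 : 1 <= n) (A : algebra n)
    (finA : finite_set [set: A]) (reprA : representable A) :
  finitely_representable A.
Proof.
case: reprA => [X [P [h [bij_h h_comp h_antidom]]]].
have finP : finite_set (elements P).
  apply: (sub_finite_set _ (finite_image (set_val \o h) finA)) => f Pf.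
  case: bij_h => h' _ hK.
  by exists (h' (SigSub (mem_set Pf))) => //=; rewrite hK.
have [T finT sepT] := finite_separating_points finP.
pose Q := localization n_ge1 P T.
have Qloc (f : set_type (elements P)) : elements Q (localize (val f)).
  by exists (val f) => //; apply: set_valP.
pose loc f : algebra_of_pfun Q := SigSub (mem_set (Qloc f)).
have bij_loc : bijective loc.
  rewrite -setTT_bijective; split=> //.
    move=> f g _ _ /(congr1 val) /= fg; apply: val_inj.
    apply: sepT; [exact: set_valP | exact: set_valP | move=> t y Tt].
    split=> [fty|gty].
      exact: localize_separates Tt (set_valP f) fty fg.
    exact: localize_separates Tt (set_valP g) gty (esym fg).
  move=> q _; have [f Pf fq] := set_valP q.
  by exists (SigSub (mem_set Pf)) => //; apply: val_inj.
exists (set_type (orbits P T)), Q; split.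
  by rewrite (eq_finite_set (card_setT _)); apply: orbits_finite.
exists (loc \o h); split.
- exact: bij_comp.
- move=> a b; apply: val_inj; rewrite /= h_comp /= localize_comp //.
  + congr graph_comp; apply: eq_from_tnth => i.
    by rewrite !tnth_map.
  + by move=> i; rewrite !tnth_map; apply: set_valP.
  + exact: set_valP.
- move=> i a; apply: val_inj; rewrite /= h_antidom /= localize_antidom //.
  exact: set_valP.
Qed.
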